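(* For $r,s\in\mathbb N$ and $m=\max(r,s)\geq1$, let $1\leq\lambda_1<\cdots<\lambda_s\leq r$ if $r\geq s$, or $1\leq\sigma_1<\cdots<\sigma_r\leq s$ and $\sigma_{r+1}=s+1$ if $r\leq s$, and let $\alpha=(\alpha_{k+m})_{k\in\mathbb N}$ in $R=\mathbb Q(b_1,\dots,b_s)[a_1,\dots,a_r]$ be the sequence defined in the context, with $a_{r+1}=1$. The generalised $m$-Stieltjes-Rogers polynomials with weights $(\alpha_{k+m})_{k\in\mathbb N}$ are $$S^{(m)}_{n,k}(\alpha)=\binom{n}{k}\,\frac{\prod_{i=1}^{r}(a_i+k)_{n-k}}{\prod_{j=1}^{s}\left(b_j^{(k)}+k\right)_{n-k}}\quad(0\le k\le n),\qquad\text{with}\quad b_j^{(k)}=b_j+\left\lceil\frac{k+1-\lambda_j}{m}\right\rceil,$$ where $\lambda_j=j$ for all $1\le j\le s$ when $r\leq s$.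
   Context: $\mathbb N=\{0,1,2,\dots\}$; $(z)_0=1$, $(z)_n=z(z+1)\cdots(z+n-1)$ for $n\ge1$. The $a_1,\dots,a_r,b_1,\dots,b_s$ are indeterminates. For integers $k$ and $n\geq1$, $[k]_n$ is the unique element of $\{1,\dots,n\}$ congruent to $k$ modulo $n$. Parameters, with $a_{r+1}=1$: if $r\geq s$, $a_i^{(k)}=a_i+\left\lceil\frac{k+1-i}{r+1}\right\rceil$ and $b_j^{(k)}=b_j+\left\lceil\frac{k+1-\lambda_j}{r}\right\rceil$; if $r\leq s$, $a_i^{(k)}=a_i+\left\lceil\frac{k+1-\sigma_i}{s+1}\right\rceil$ and $b_j^{(k)}=b_j+\left\lceil\frac{k+1-j}{s}\right\rceil$ (for $1\le i\le r+1$, $1\le j\le s$; the two agree when $r=s$). Coefficients, for $k\in\mathbb N$. If $r\ge s$: $\alpha_{k+r}=\dfrac{\prod_{i=1,i\neq[k]_{r+1}}^{r+1}a_i^{(k)}}{\prod_{j=1}^{s}b_j^{(k)}}$ if $[k]_r\notin\{\lambda_1,\dots,\lambda_s\}$, and $\alpha_{k+r}=\dfrac{\left(b_\ell^{(k)}-a_{[k]_{r+1}}^{(k)}\right)\prod_{i=1,i\neq[k]_{r+1}}^{r+1}a_i^{(k)}}{\left(b_\ell^{(k)}-1\right)\prod_{j=1}^{s}b_j^{(k)}}$ if $[k]_r=\lambda_\ell$. If $r\le s$: $\alpha_{k+s}=-\dfrac{\prod_{i=1}^{r+1}a_i^{(k)}}{\left(b_{[k]_s}^{(k)}-1\right)\prod_{j=1}^{s}b_j^{(k)}}$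 if $[k]_{s+1}\notin\{\sigma_1,\dots,\sigma_{r+1}\}$, and $\alpha_{k+s}=\dfrac{\left(b_{[k]_s}^{(k)}-a_\ell^{(k)}\right)\prod_{i=1,i\neq\ell}^{r+1}a_i^{(k)}}{\left(b_{[k]_s}^{(k)}-1\right)\prod_{j=1}^{s}b_j^{(k)}}$ if $[k]_{s+1}=\sigma_\ell$. Generalised $m$-Stieltjes-Rogers polynomials: a partial $m$-Dyck path is a finite path in $\mathbb N\times\mathbb N$ with steps $(1,1)$ (weight $1$) and $(1,-m)$ (weight $\alpha_i$ when starting from height $i$); $S^{(m)}_{n,k}(\alpha)$ is the sum of the weights (products of step weights) of the partial $m$-Dyck paths from $(0,0)$ to $((m+1)n,(m+1)k)$. (It is $0$ when $k>n$.) *)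

(* Defs.v *)
From HB Require Import structures.
From mathcomp Require Import all_boot all_order all_algebra.
From mathcomp Require Export fraction mpoly.

Set Implicit Arguments.
Unset Strict Implicit.
Unset Printing Implicit Defensive.

Import Order.TTheory GRing.Theory Num.Theory.
Local Open Scope ring_scope.

(* Finite families a_1, ..., a_N are encoded as functions on nat whose values
   outside 1, ..., N are never used. *)

(* [k]_n, for n >= 1 *)
Definition resid (k n : nat) : nat := if (n %| k)%N then n else (k %% n)%N.

Definition rising (R : pzSemiRingType) (z : R) (n : nat) : R :=
  \prod_(0 <= i < n) (z + i%:R).

(* 1 <= f 1 < ... < f N <= M *)
Definition chain (f : nat -> nat) (N M : nat) : Prop :=
  (forall i, (1 <= i <= N)%N -> (1 <= f i <= M)%N) /\
  (forall i j, (1 <= i)%N -> (i < j)%N -> (j <= N)%N -> (f i < f j)%N).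

(* z + ceil ((k + 1 - t) / d); the subtraction takes place in rat and may be
   negative. *)
Definition shifted (R : pzRingType) (z : R) (k t d : nat) : R :=
  z + (Num.ceil ((k%:R + 1 - t%:R) / d%:R : rat))%:~R.

Section Coefficients.

Variables (R : comUnitRingType) (r s : nat) (a b : nat -> R).

(* In both definitions the value at k is the coefficient alpha_{k+m}, with
   m = maxn r s. *)

Definition alpha_ge (lam : nat -> nat) (k : nat) : R :=
  let ak i := shifted (a i) k i r.+1 in
  let bk j := shifted (b j) k (lam j) r in
  let u := resid k r.+1 in
  let num := \prod_(1 <= i < r.+2 | i != u) ak i in
  let den := \prod_(1 <= j < s.+1) bk j in
  if [pick l : 'I_s | lam l.+1 == resid k r] is Some l then
    ((bk l.+1 - ak u) * num) / ((bk l.+1 - 1) * den)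
  else num / den.

Definition alpha_le (sig : nat -> nat) (k : nat) : R :=
  let ak i := shifted (a i) k (sig i) s.+1 in
  let bk j := shifted (b j) k j s in
  let v := resid k s in
  let den := (bk v - 1) * \prod_(1 <= j < s.+1) bk j in
  if [pick l : 'I_r.+1 | sig l.+1 == resid k s.+1] is Some l then
    ((bk v - ak l.+1) * \prod_(1 <= i < r.+2 | i != l.+1) ak i) / den
  else - ((\prod_(1 <= i < r.+2) ak i) / den).

Definition closed_form (m : nat) (lam : nat -> nat) (n k : nat) : R :=
  'C(n, k)%:R *
  ((\prod_(1 <= i < r.+1) rising (a i + k%:R) (n - k)) /
   (\prod_(1 <= j < s.+1) rising (shifted (b j) k (lam j) m + k%:R) (n - k))).

End Coefficients.

Section StieltjesRogers.

Variables (R : pzSemiRingType) (m : nat).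

(* A path is given by its sequence of steps: true is (1, 1) and false is
   (1, -m). The test holds when the path starting from height h stays at
   nonnegative heights and ends at height h'. *)
Fixpoint partial_dyck (h : nat) (p : seq bool) (h' : nat) : bool :=
  match p with
  | [::] => h == h'
  | true :: q => partial_dyck h.+1 q h'
  | false :: q => (m <= h)%N && partial_dyck (h - m) q h'
  end.

(* A fall from height i >= m has weight alpha_i = w (i - m). *)
Fixpoint path_weight (w : nat -> R) (h : nat) (p : seq bool) : R :=
  match p with
  | [::] => 1
  | true :: q => path_weight w h.+1 q
  | false :: q => w (h - m)%N * path_weight w (h - m) q
  end.

(* Every step advances the abscissa by 1, so the paths with final abscissa
   (m + 1) n are those with (m + 1) n steps. *)
Definition stieltjes_rogers (w : nat -> R) (n k : nat) : R :=
  \sum_(p : (m.+1 * n).-tuple bool | partial_dyck 0 p (m.+1 * k))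
     path_weight w 0 p.

End StieltjesRogers.

(* Q(b_1, ..., b_s)[a_1, ..., a_r]; its units are the nonzero elements of
   Q(b_1, ..., b_s). *)
Notation Qb s := {fraction {mpoly rat[s]}}.
Notation Rab r s := {mpoly (Qb s)[r]}.

(* a_i for 1 <= i <= r, and a_{r+1} = 1 *)
Definition avar (r s i : nat) : Rab r s :=
  if (insub i.-1 : option 'I_r) is Some j then 'X_j else 1.

(* b_j for 1 <= j <= s *)
Definition bvar (r s j : nat) : Rab r s :=
  if (insub j.-1 : option 'I_s) is Some l then
    (tofrac ('X_l : {mpoly rat[s]}))%:MP_[r]
  else 0.

(* Main.v *)
(** Let P(t, h) be the total weight of the paths with h + (m + 1) t steps from
    height 0 to height h. Removing the last step gives
      P(t, h) = P(t, h - 1) + alpha_(h + m) P(t - 1, h + m).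
    On the other side, let F(t, h) be the coefficient of x^t in the
    hypergeometric series (r+1)F(s) with numerator parameters a_i^(h) and
    denominator parameters b_j^(h). Passing from h - 1 to h raises by 1 the at
    most one a_i^(h) with sigma_i = [h]_(m+1) and the at most one b_j^(h) with
    lambda_j = [h]_m, where sigma_i = i if r >= s and lambda_j = j if r <= s;
    passing from h to h + m + 1 raises every a_i^(h) by 1, and from h to h + m
    every b_j^(h). So F satisfies the same recurrence by three contiguity
    relations, one for each form of alpha. Since a_(r+1) = 1, the last
    numerator parameter vanishes at h = -1, which gives the boundary case, and
    P = F. At height (m + 1) k that parameter is 1 + k, the source of the
    binomial coefficient. *)

Require Import Defs.
From mathcomp Require Import all_boot all_order all_algebra.
From mathcomp Require Import zify ring lra.

Set Implicit Arguments.
Unset Strict Implicit.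
Unset Printing Implicit Defensive.

Import Order.TTheory GRing.Theory Num.Theory.
Local Open Scope ring_scope.

(** * Path sums, split at the first and at the last step *)

Section PathSums.

Variables (R : comPzRingType) (m : nat) (w : nat -> R).

Definition path_sum (N h h' : nat) : R :=
  \sum_(p : N.-tuple bool | partial_dyck m h p h') path_weight m w h p.

Lemma path_sum0 h h' : path_sum 0 h h' = (h == h')%:R.
Proof.
rewrite /path_sum (eq_bigl (fun _ => h == h')) => [|p]; last by rewrite tuple0.
case: eqP => _; last by rewrite big_pred0_eq.
by rewrite (big_pred1 [tuple]) // => p; apply/esym/eqP; rewrite tuple0.
Qed.

Lemma path_sum_first N h h' :
  path_sum N.+1 h h' =
  path_sum N h.+1 h' + (m <= h)%:R * (w (h - m) * path_sum N (h - m) h').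
Proof.
have split_head P F : \sum_(p : N.+1.-tuple bool | P (tval p)) F (tval p) =
    \sum_(p : N.-tuple bool | P (true :: p)) F (true :: p) +
    \sum_(p : N.-tuple bool | P (false :: p)) F (false :: p) :> R.
  rewrite (reindex (fun q : bool * N.-tuple bool => [tuple of q.1 :: q.2])) /=;
    last first.
    exists (fun p : N.+1.-tuple bool => (thead p, behead_tuple p))
      => [[c q] _|p _].
      by rewrite /= theadE; congr (_, _); apply/val_inj.
    by case: p => -[|c q] // sq; apply/val_inj.
  rewrite -(pair_big_dep predT (fun c (q : N.-tuple bool) => P (c :: q))
              (fun c q => F (c :: q))) /=.
  by rewrite big_bool.
rewrite /path_sum (split_head (fun p => partial_dyck m h p h')
                    (fun p => path_weight m w h p)) /=.
case: leqP => _; first by rewrite mul1r -big_distrr.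
by rewrite mul0r big_pred0_eq.
Qed.

(** Induction on the length through the first-step decomposition: splitting off the first step
    commutes with splitting off the last one. The factor [(0 < h')%:R] discards the truncated
    predecessor of 0. *)
Lemma path_sum_last N h h' :
  path_sum N.+1 h h' =
  (0 < h')%:R * path_sum N h h'.-1 + w h' * path_sum N h (h' + m).
Proof.
elim: N h => [|N IHN] h.
  rewrite path_sum_first !path_sum0; congr (_ + _).
    by case: h' => [|h'] /=; rewrite ?mul0r // mul1r eqSS.
  case: leqP => mh; last first.
    by rewrite mul0r; case: eqP => [?|_]; [lia | rewrite mulr0].
  rewrite mul1r; case: eqP => [<-|ne]; first by rewrite subnK // eqxx.
  by case: eqP => [?|_]; [case: ne; lia | rewrite !mulr0].
rewrite path_sum_first !IHN [path_sum N.+1 h h'.-1]path_sum_first.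
rewrite [path_sum N.+1 h (_ + _)]path_sum_first.
ring.
Qed.

Lemma path_sum_eq0 N h h' : (h + N < h')%N -> path_sum N h h' = 0.
Proof.
elim: N h' => [|N IHN] h' lt_hN.
  by rewrite path_sum0; case: eqP => [?|//]; lia.
by rewrite path_sum_last !IHN ?mulr0 ?addr0 //; lia.
Qed.

(** A path of [N] steps from 0 with [t] falls ends at height [N - (m + 1) t], so in [F t h] the
    index [t] counts the falls, and the recurrence determines [F] by induction on [N]. *)
Lemma stieltjes_rogers_unique (F : nat -> nat -> R) :
    (forall h, F 0%N h = 1) ->
    (forall t, F t.+1 0%N = w 0%N * F t m) ->
    (forall t h, F t.+1 h.+1 = F t.+1 h + w h.+1 * F t (h.+1 + m)%N) ->
  forall n k, (k <= n)%N -> stieltjes_rogers m w n k = F (n - k)%N (m.+1 * k)%N.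
Proof.
move=> F0 FS0 FSS n k le_kn.
have path_sumF N t h : (h + m.+1 * t = N)%N -> path_sum N 0 h = F t h.
  elim: N t h => [|N IHN] [|t] h eqN.
  - by rewrite path_sum0 F0; case: eqP => [//|?]; lia.
  - lia.
  (* Without falls, the last step is a rise: height [h + m] is out of reach in [N] steps. *)
  - rewrite path_sum_last [path_sum N 0 (h + m)]path_sum_eq0; last by lia.
    have h_gt0 : (0 < h)%N by lia.
    by rewrite h_gt0 (IHN 0%N) ?F0 ?mulr0 ?addr0 ?mul1r //; lia.
  - rewrite path_sum_last [path_sum N 0 (h + m)](IHN t); last first.
      by move: eqN; rewrite mulnS; lia.
    case: h eqN => [|h] eqN /=; first by rewrite mul0r add0r FS0 add0n.
    by rewrite mul1r (IHN t.+1) ?FSS //; lia.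
by apply: path_sumF; rewrite -mulnDr subnKC.
Qed.

End PathSums.

(** * Rising factorials *)

Section Rising.

Variable R : comPzRingType.
Implicit Types z : R.

Lemma rising0 z : rising z 0 = 1.
Proof. by rewrite /rising big_geq. Qed.

Lemma risingSr z n : rising z n.+1 = rising z n * (z + n%:R).
Proof. by rewrite /rising big_nat_recr. Qed.

Lemma risingS z n : rising z n.+1 = z * rising (z + 1) n.
Proof.
rewrite /rising big_nat_recl // addr0; congr (_ * _).
by apply: eq_bigr => i _; rewrite -addrA -[1]/(1%:R) -natrD.
Qed.

Lemma rising_subr1 z n : rising (z - 1) n.+1 = (z - 1) * rising z n.
Proof. by rewrite risingS subrK. Qed.

Lemma rising_bin k n : rising (1 + k%:R : R) n = n`!%:R * 'C(k + n, k)%:R.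
Proof.
elim: n => [|n IHn]; first by rewrite rising0 addn0 binn mulr1.
rewrite risingSr IHn -!natrM -[1]/(1%:R) -!natrD -natrM; congr _%:R.
(* Multiplying by [k!] turns both binomials into quotient-free factorial identities over [nat]. *)
have fk := fact_gt0 k; apply/eqP; rewrite -(eqn_pmul2r fk); apply/eqP.
have := bin_fact (leq_addr n k); have := bin_fact (leq_addr n.+1 k).
rewrite !addKn [in X in _ = X -> _]addnS => eqS eqn.
transitivity ((k + n).+1 * ('C(k + n, k) * (k`! * n`!)))%N; first by lia.
by rewrite eqn -factS -eqS; lia.
Qed.

Lemma prod_risingS (I : Type) (J : seq I) (P : pred I) (z : I -> R) n :
  \prod_(i <- J | P i) rising (z i) n.+1 =
  (\prod_(i <- J | P i) z i) * \prod_(i <- J | P i) rising (z i + 1) n.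
Proof. by rewrite -big_split; apply: eq_bigr => i _; rewrite risingS. Qed.

End Rising.

(** * Contiguity relations between hypergeometric coefficients *)

Section Contiguity.

Variables (R : comUnitRingType) (K : eqType) (I J : seq K).
Hypotheses (uniqI : uniq I) (uniqJ : uniq J).
Hypothesis natU : forall n, n.+1%:R \is a @GRing.unit R.
Implicit Types x y : K -> R.

(** Coefficient of degree [t] in the generalised hypergeometric series with upper parameters [x] on
    [I] and lower parameters [y] on [J]. *)
Definition hyper_coef (t : nat) x y : R :=
  (\prod_(i <- I) rising (x i) t) / (t`!%:R * \prod_(j <- J) rising (y j) t).

Lemma eq_hyper_coef t x x' y y' :
    {in I, x =1 x'} -> {in J, y =1 y'} ->
  hyper_coef t x y = hyper_coef t x' y'.
Proof.
move=> eqx eqy; rewrite /hyper_coef; congr (_ / (_ * _)).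
  by rewrite !big_seq; apply: eq_bigr => i /eqx ->.
by rewrite !big_seq; apply: eq_bigr => i /eqy ->.
Qed.

Lemma hyper_coef0 x y : hyper_coef 0 x y = 1.
Proof.
by rewrite /hyper_coef !big1 ?mulr1 ?divr1 // => i _; rewrite rising0.
Qed.

Lemma hyper_coef_eq0 t x y i : i \in I -> x i = 0 -> hyper_coef t.+1 x y = 0.
Proof.
move=> Ii xi0; rewrite /hyper_coef (bigD1_seq i) //= xi0.
by rewrite risingS !mul0r.
Qed.

Lemma fact_unit n : n`!%:R \is a @GRing.unit R.
Proof. by rewrite -(prednK (fact_gt0 n)). Qed.

Lemma invr_fact n : n`!%:R^-1 = n.+1%:R * n.+1`!%:R^-1 :> R.
Proof. by rewrite factS natrM invrM ?fact_unit // mulrC mulrVK. Qed.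

Lemma rising_unit (z : R) n :
  (forall c : int, z + c%:~R \is a GRing.unit) -> rising z n \is a GRing.unit.
Proof.
by move=> zU; apply: rpred_prod => i _; have := zU i; rewrite -pmulrn.
Qed.

Section Split.

Variables (L : seq K) (u : K) (x : K -> R) (t : nat).
Hypotheses (uniqL : uniq L) (Lu : u \in L).

(** Once [rest] is factored out, only the entry at [u] distinguishes the products below. In
    [prod_rising_inc] the missing half of [rest], the product of the [x i], is supplied by the
    weight. *)
Let rest : R :=
  (\prod_(i <- L | i != u) x i) * \prod_(i <- L | i != u) rising (x i + 1) t.

Lemma prod_rising_at :
  \prod_(i <- L) rising (x i) t.+1 = rising (x u) t.+1 * rest.
Proof. by rewrite (bigD1_seq u) //= prod_risingS. Qed.

Lemma prod_rising_dec :
  \prod_(i <- L) rising (x i - (i == u)%:R) t.+1 =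
  (x u - 1) * rising (x u) t * rest.
Proof.
rewrite (bigD1_seq u) //= eqxx rising_subr1 /rest -prod_risingS; congr (_ * _).
by apply: eq_bigr => i /negPf ->; rewrite subr0.
Qed.

Lemma prod_rising_inc :
  \prod_(i <- L) rising (x i + (i != u)%:R) t =
  rising (x u) t * \prod_(i <- L | i != u) rising (x i + 1) t.
Proof.
rewrite (bigD1_seq u) //= eqxx addr0; congr (_ * _).
by apply: eq_bigr => i ->.
Qed.

End Split.

Section Units.

Variable y : K -> R.
Hypothesis yU : {in J, forall j (c : int), y j + c%:~R \is a GRing.unit}.

Lemma prod_unit (P : pred K) : \prod_(j <- J | P j) y j \is a GRing.unit.
Proof.
rewrite big_seq_cond; apply: rpred_prod => j /andP[Jj _].
by have := yU Jj 0; rewrite addr0.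
Qed.

Lemma prod_rising_unit (P : pred K) t :
  \prod_(j <- J | P j) rising (y j + 1) t \is a GRing.unit.
Proof.
rewrite big_seq_cond; apply: rpred_prod => j /andP[Jj _].
by apply: rising_unit => c; have := yU Jj (1 + c); rewrite rmorphD addrA.
Qed.

(** With X = [x u], cancelling the common factors leaves (X + t) = (X - 1) + (t + 1). *)
Lemma contiguity_num t x u : u \in I ->
  hyper_coef t.+1 x y =
  hyper_coef t.+1 (fun i => x i - (i == u)%:R) y +
  (\prod_(i <- I | i != u) x i) / (\prod_(j <- J) y j) *
    hyper_coef t (fun i => x i + (i != u)%:R) (fun j => y j + 1).
Proof.
move=> Iu; rewrite /hyper_coef (prod_rising_at x t uniqI Iu).
rewrite (prod_rising_dec x t uniqI Iu) (prod_rising_inc x t uniqI Iu).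
rewrite prod_risingS risingSr.
rewrite !invrM ?unitrM ?prod_unit ?prod_rising_unit ?fact_unit // (invr_fact t).
ring.
Qed.

Section AtDenominator.

Variables (v : K) (Jv : v \in J).

Let yvU (c : int) : y v + c%:~R \is a GRing.unit := yU Jv c.

Let yvtU n : y v + n%:R \is a GRing.unit.
Proof. by have := yvU n; rewrite -pmulrn. Qed.

Let yv1U : y v - 1 \is a GRing.unit.
Proof. by have := yvU (-1); rewrite rmorphN. Qed.

(** This and [inv_dec] bring 1/(Y + t) and 1/(Y - 1), where Y = [y v], to a common denominator,
    after which the relations are polynomial in the inverses. *)
Let inv_at t :
  (y v + t%:R)^-1 = (y v + t%:R)^-1 * ((y v - 1) * (y v - 1)^-1).
Proof. by rewrite mulrV ?mulr1. Qed.

Let inv_dec t :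
  (y v - 1)^-1 = (y v - 1)^-1 * ((y v + t%:R) * (y v + t%:R)^-1).
Proof. by rewrite mulrV ?mulr1 ?yvtU. Qed.

Let rest t : R := (\prod_(j <- J | j != v) y j)^-1 *
  (\prod_(j <- J | j != v) rising (y j + 1) t)^-1 * (rising (y v) t)^-1.

Lemma invr_prod_rising_at t :
  (t.+1`!%:R * \prod_(j <- J) rising (y j) t.+1)^-1 =
  t.+1`!%:R^-1 * rest t * (y v + t%:R)^-1.
Proof.
rewrite (prod_rising_at y t uniqJ Jv) risingSr.
rewrite !invrM ?unitrM ?prod_unit ?prod_rising_unit ?fact_unit ?rising_unit
  ?yvtU //.
by rewrite /rest; ring.
Qed.

Lemma invr_prod_rising_dec t :
  (t.+1`!%:R * \prod_(j <- J) rising (y j - (j == v)%:R) t.+1)^-1 =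
  t.+1`!%:R^-1 * rest t * (y v - 1)^-1.
Proof.
rewrite (prod_rising_dec y t uniqJ Jv).
rewrite !invrM ?unitrM ?prod_unit ?prod_rising_unit ?fact_unit ?rising_unit
  ?yv1U //.
by rewrite /rest; ring.
Qed.

Lemma invr_prod_rising_inc t :
  ((y v - 1) * \prod_(j <- J) y j)^-1 *
    (t`!%:R * \prod_(j <- J) rising (y j + 1) t)^-1 =
  t.+1%:R * t.+1`!%:R^-1 * rest t * (y v + t%:R)^-1 * (y v - 1)^-1.
Proof.
have y0U : y v \is a GRing.unit by have := yvtU 0; rewrite addr0.
have y1U : rising (y v + 1) t \is a GRing.unit.
  by apply: rising_unit => c; have := yvU (1 + c); rewrite rmorphD addrA.
(* The rising factorial of length t + 1 at Y = [y v] splits off either its first factor Y or its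
   last factor Y + t. *)
have eqY : (y v)^-1 * (rising (y v + 1) t)^-1 =
           (rising (y v) t)^-1 * (y v + t%:R)^-1.
  rewrite [LHS]mulrC -(invrM y0U y1U) -risingS risingSr.
  by rewrite invrM ?rising_unit // mulrC.
rewrite (bigD1_seq v) //= [\prod_(j <- J) _](bigD1_seq v) //=.
rewrite !invrM ?unitrM ?prod_unit ?prod_rising_unit ?fact_unit
  ?y0U ?y1U ?yv1U //.
rewrite (invr_fact t); transitivity (t.+1%:R * t.+1`!%:R^-1 *
    ((\prod_(j <- J | j != v) y j)^-1 *
     (\prod_(j <- J | j != v) rising (y j + 1) t)^-1) *
    ((y v)^-1 * (rising (y v + 1) t)^-1) * (y v - 1)^-1); first by ring.
by rewrite eqY /rest; ring.
Qed.

(** With Y = [y v], clearing denominators leaves (Y - 1) = (Y + t) - (t + 1). *)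
Lemma contiguity_den t x :
  hyper_coef t.+1 x y =
  hyper_coef t.+1 x (fun j => y j - (j == v)%:R) +
  - ((\prod_(i <- I) x i) / ((y v - 1) * \prod_(j <- J) y j)) *
    hyper_coef t (fun i => x i + 1) (fun j => y j + 1).
Proof.
rewrite /hyper_coef mulNr mulrACA invr_prod_rising_inc -prod_risingS.
rewrite invr_prod_rising_at invr_prod_rising_dec.
by rewrite {1}(inv_dec t) {1}(inv_at t); ring.
Qed.

(* With X = x u and Y = y v, both sides reduce to
   (X + t) (Y - 1) - (X - 1) (Y + t) = (t + 1) (Y - X). *)
Lemma contiguity_num_den t x u : u \in I ->
  hyper_coef t.+1 x y =
  hyper_coef t.+1 (fun i => x i - (i == u)%:R) (fun j => y j - (j == v)%:R) +
  ((y v - x u) * \prod_(i <- I | i != u) x i) /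
    ((y v - 1) * \prod_(j <- J) y j) *
    hyper_coef t (fun i => x i + (i != u)%:R) (fun j => y j + 1).
Proof.
move=> Iu; rewrite /hyper_coef mulrACA invr_prod_rising_inc.
rewrite (prod_rising_at x t uniqI Iu) risingSr.
rewrite (prod_rising_dec x t uniqI Iu) (prod_rising_inc x t uniqI Iu).
rewrite invr_prod_rising_at invr_prod_rising_dec.
by rewrite {1}(inv_dec t) {1}(inv_at t); ring.
Qed.

End AtDenominator.

End Units.

End Contiguity.

(** * Shifted parameters as functions of the height *)

Section Shifts.

Variables (R : comPzRingType) (d : nat).
Implicit Types (z : R) (t : nat).

(** Both sides say that h and t are congruent modulo d; adding [d] keeps the natural subtraction
    exact. *)
Lemma dvdn_resid h t : (1 <= t <= d)%N ->
  (d %| h + d - t)%N = (t == resid h d).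
Proof.
move=> /andP[t_gt0 t_led]; have d_gt0 : (0 < d)%N by lia.
rewrite -addnBA // /dvdn -modnDml /resid /dvdn.
have := ltn_pmod h d_gt0; move: (h %% d)%N => p p_ltd.
case: (ltnP (p + (d - t)) d) => [lt_d|ge_d].
  by rewrite modn_small //; case: (p =P 0%N) => ?; apply/eqP/eqP; lia.
rewrite -(subnK ge_d) modnDr modn_small; last by lia.
by case: (p =P 0%N) => ?; apply/eqP/eqP; lia.
Qed.

Lemma resid_addr h : resid (h + d) d = resid h d.
Proof. by rewrite /resid modnDr dvdn_addl. Qed.

(** The ceiling of (h + 1 - t)/d is the floor of (h + d - t)/d, which is a quotient of naturals
    because t is at most d. *)
Lemma shiftedE z h t : (1 <= t <= d)%N ->
  shifted z h t d = z + ((h + d - t) %/ d)%:R.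
Proof.
move=> /andP[t_gt0 t_led]; have d_gt0 : (0 < d)%N by lia.
rewrite /shifted [_%:R in RHS]pmulrn; congr (_ + _%:~R).
apply: Num.Theory.ceil_def.
have dR : 0 < d%:R :> rat by rewrite ltr0n.
have q_lt : (h + d - t < ((h + d - t) %/ d).+1 * d)%N by rewrite ltn_ceil.
have q_ge := leq_divM (h + d - t) d.
move: (_ %/ d)%N q_lt q_ge => q q_lt q_ge.
rewrite rmorphB /= -pmulrn ltr_pdivlMr // ler_pdivrMr //.
have lt1 : (q * d + t < h + 1 + d)%N by lia.
have le2 : (h + 1 <= q * d + t)%N by lia.
move: lt1 le2; rewrite -(ltr_nat rat) -(ler_nat rat) !natrD natrM => lt1 le2.
by apply/andP; split; lra.
Qed.

Lemma shifted0 z t : (1 <= t <= d)%N -> shifted z 0 t d = z.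
Proof. by move=> td; rewrite shiftedE // divn_small ?addr0 //; lia. Qed.

(** The quotient grows exactly when [d] divides the new dividend. The subtraction on the left
    matches the lowered parameters of the contiguity relations. *)
Lemma shiftedS z h t : (1 <= t <= d)%N ->
  shifted z h.+1 t d - (t == resid h.+1 d)%:R = shifted z h t d.
Proof.
move=> td; rewrite !shiftedE // -dvdn_resid //.
have -> : (h.+1 + d - t = (h + d - t).+1)%N by lia.
by rewrite divnS; [rewrite natrD; ring | lia].
Qed.

Lemma shifted_addr z h t k : (1 <= t <= d)%N ->
  shifted z (h + d * k) t d = shifted z h t d + k%:R.
Proof.
move=> td; rewrite !shiftedE //.
have -> : (h + d * k + d - t = k * d + (h + d - t))%N by lia.
by rewrite divnMDl; [rewrite natrD; ring | lia].
Qed.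

End Shifts.

(** Climbing m + 1 raises the parameter by 1; stepping back once undoes this exactly when t is the
    residue of h. *)
Lemma shifted_add_pred (R : comPzRingType) (z : R) h t m : (1 <= t <= m.+1)%N ->
  shifted z (h + m) t m.+1 = shifted z h t m.+1 + (t != resid h m.+1)%:R.
Proof.
move=> tm; rewrite -shiftedS // -addnS resid_addr.
have := shifted_addr z h 1 tm; rewrite muln1 => ->.
by case: eqP => _ /=; ring.
Qed.

Lemma shifted_unit (R : comUnitRingType) (z : R) h t d :
    (forall c : int, z + c%:~R \is a GRing.unit) ->
  forall c : int, shifted z h t d + c%:~R \is a GRing.unit.
Proof. by move=> zU c; rewrite /shifted -addrA -rmorphD; apply: zU. Qed.

(** * From the contiguity relations to the closed form, for both regimes at once *)

Section Recurrence.

Variables (R : comUnitRingType) (r s m : nat) (a b : nat -> R).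
Variables (sig lam : nat -> nat) (w : nat -> R).
Hypothesis natU : forall n, n.+1%:R \is a @GRing.unit R.
Hypotheses (a_last : a r.+1 = 1) (sig_last : sig r.+1 = m.+1).
Hypothesis sigP : forall i, (1 <= i <= r.+1)%N -> (1 <= sig i <= m.+1)%N.
Hypothesis lamP : forall j, (1 <= j <= s)%N -> (1 <= lam j <= m)%N.

Hypothesis bU : forall j, (1 <= j <= s)%N ->
  forall c : int, b j + c%:~R \is a GRing.unit.

Let I := index_iota 1 r.+2.
Let J := index_iota 1 s.+1.
Let A h i := shifted (a i) h (sig i) m.+1.
Let B h j := shifted (b j) h (lam j) m.

(** Common shape of the three contiguity relations: indicators of residues replace the distinguished
    indices. *)
Hypothesis weightE : forall t h,
  hyper_coef I J t.+1 (A h) (B h) =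
  hyper_coef I J t.+1 (fun i => A h i - (sig i == resid h m.+1)%:R)
                      (fun j => B h j - (lam j == resid h m)%:R) +
  w h * hyper_coef I J t (fun i => A h i + (sig i != resid h m.+1)%:R)
                         (fun j => B h j + 1).

Let sigI i : i \in I -> (1 <= sig i <= m.+1)%N.
Proof. by rewrite mem_index_iota => /sigP. Qed.

Let lamJ j : j \in J -> (1 <= lam j <= m)%N.
Proof. by rewrite mem_index_iota => /lamP. Qed.

Let BU h : {in J, forall j (c : int), B h j + c%:~R \is a GRing.unit}.
Proof. by move=> j; rewrite mem_index_iota => /bU; apply: shifted_unit. Qed.

Lemma stieltjes_rogers_closed_form n k : (k <= n)%N ->
  stieltjes_rogers m w n k = closed_form r s a b m lam n k.
Proof.
pose F t h := hyper_coef I J t (A h) (B h).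
have Fnext t h :
    hyper_coef I J t (fun i => A h i + (sig i != resid h m.+1)%:R)
                     (fun j => B h j + 1) = F t (h + m)%N.
  apply: eq_hyper_coef => [i /sigI tm|j /lamJ tm].
    by rewrite -shifted_add_pred.
  by have := shifted_addr (b j) h 1 tm; rewrite muln1.
move=> le_kn; rewrite (@stieltjes_rogers_unique _ _ _ F) // => [|h|t|t h].
(* Height (m + 1) k is k periods of length m + 1 above 0, and k periods of length m above k. *)
- have eqA i : i \in I -> A (m.+1 * k) i = a i + k%:R.
    move=> /sigI tm; rewrite -[(m.+1 * k)%N]add0n /A.
    by rewrite shifted_addr // shifted0.
  have eqB j : j \in J -> B (m.+1 * k) j = B k j + k%:R.
    by move=> /lamJ tm; rewrite mulSn /B shifted_addr.
  rewrite /F (eq_hyper_coef _ eqA eqB) /hyper_coef /closed_form.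
  (* The last upper parameter is 1 + k; its rising factorial is (n - k)! times the binomial, and (n
     - k)! cancels. *)
  rewrite [in LHS]big_nat_recr //= a_last rising_bin subnKC //.
  rewrite invrM ?fact_unit //; last first.
    rewrite big_seq; apply: rpred_prod => j Jj; apply: rising_unit => c.
    have := BU k Jj (k%:Z + c); rewrite rmorphD /= -pmulrn addrA.
    by rewrite /B.
  rewrite -[RHS]mulr1 -[X in _ = _ * X](mulrV (fact_unit natU (n - k))).
  by rewrite -/J -/B; ring.
- by rewrite /F hyper_coef0.
(* At h = 0 the residue modulo m + 1 is m + 1 = [sig r.+1], so the last upper parameter drops from 1
   to 0 and the first term vanishes. *)
- have I_last : r.+1 \in I by rewrite mem_index_iota /=.
  rewrite /F weightE Fnext (hyper_coef_eq0 _ (iota_uniq _ _) _ _ I_last).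
    by rewrite add0r.
  by rewrite /A sig_last shifted0 /= ?leqnn // a_last /resid dvdn0 eqxx subrr.
- rewrite /F weightE Fnext; congr (_ + _).
  apply: eq_hyper_coef => [i /sigI tm|j /lamJ tm]; exact: shiftedS.
Qed.

End Recurrence.

Lemma chain_eq f N M i j : chain f N M ->
  (1 <= i <= N)%N -> (1 <= j <= N)%N -> (f i == f j) = (i == j).
Proof.
move=> [_ f_incr] iN jN; case: (ltngtP i j) => [ij|ji|->]; last exact: eqxx.
  by have := f_incr i j; lia.
by have := f_incr j i; lia.
Qed.

Lemma resid_bounds h d : (0 < d)%N -> (1 <= resid h d <= d)%N.
Proof.
move=> d_gt0; rewrite /resid /dvdn; have := ltn_pmod h d_gt0.
by case: eqP => //; lia.
Qed.

(** * The explicit weights satisfy the contiguity relations *)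

Section Weights.

Variables (R : comUnitRingType) (r s : nat) (a b : nat -> R).
Hypothesis natU : forall n, n.+1%:R \is a @GRing.unit R.
Hypothesis a_last : a r.+1 = 1.
Hypothesis bU : forall j, (1 <= j <= s)%N ->
  forall c : int, b j + c%:~R \is a GRing.unit.

Let I := index_iota 1 r.+2.
Let J := index_iota 1 s.+1.

Let shiftedU (d : nat -> nat) n h :
  {in J, forall j (c : int),
    shifted (b j) h (d j) n + c%:~R \is a GRing.unit}.
Proof. by move=> j; rewrite mem_index_iota => /bU; apply: shifted_unit. Qed.

Lemma stieltjes_rogers_alpha_ge lam n k : (0 < r)%N -> chain lam s r ->
    (k <= n)%N ->
  stieltjes_rogers r (alpha_ge r s a b lam) n k = closed_form r s a b r lam n k.
Proof.
move=> r_gt0 lamC; apply: (@stieltjes_rogers_closed_form _ r s r a b id) => //.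
  exact: lamC.1.
move=> t h; rewrite /alpha_ge; set u := resid h r.+1.
have Iu : u \in I by rewrite mem_index_iota ltnS resid_bounds.
(* Here [sig] is the identity, so the upper parameter at [u] always drops; a lower one drops too
   only if some [lam] value meets the residue. *)
case: pickP => [l /eqP lamE|lam_none].
  have Jl : l.+1 \in J by rewrite mem_index_iota /= ltnS.
  rewrite (contiguity_num_den (iota_uniq _ _) (iota_uniq _ _) natU
    (shiftedU _ _ _) Jl t _ Iu); congr (_ + _).
  apply: eq_hyper_coef => // j; rewrite mem_index_iota => js.
  by rewrite -lamE (chain_eq (j := l.+1) lamC js (ltn_ord l)).
rewrite (contiguity_num (iota_uniq _ _) natU (shiftedU _ _ _) t _ Iu).
congr (_ + _); apply: eq_hyper_coef => // j; rewrite mem_index_iota.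
case: j => // j js; have /= -> := lam_none (Ordinal (js : j < s)%N).
by rewrite subr0.
Qed.

Lemma stieltjes_rogers_alpha_le sig n k : (0 < s)%N -> chain sig r s ->
    sig r.+1 = s.+1 -> (k <= n)%N ->
  stieltjes_rogers s (alpha_le r s a b sig) n k =
  closed_form r s a b s id n k.
Proof.
move=> s_gt0 sigC sig_last.
(* The value s + 1 extends the chain, so injectivity of [sig] also covers the index r + 1. *)
have sigC1 : chain sig r.+1 s.+1.
  split=> [i|i j i1 ij].
    case: (i =P r.+1) => [->|ne] ir; first by rewrite sig_last; lia.
    by have := sigC.1 i; lia.
  case: (j =P r.+1) => [jE|ne] jr; last by apply: sigC.2 => //; lia.
  by rewrite jE sig_last; have := sigC.1 i; lia.
apply: (@stieltjes_rogers_closed_form _ r s s a b sig) => //.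
  exact: sigC1.1.
move=> t h; rewrite /alpha_le; set v := resid h s.
have Jv : v \in J by rewrite mem_index_iota ltnS resid_bounds.
case: pickP => [l /eqP sigE|sig_none].
  have Il : l.+1 \in I by rewrite mem_index_iota /= ltnS.
  have eq_sig i : i \in I -> (sig i == resid h s.+1) = (i == l.+1).
    by rewrite mem_index_iota => ir; rewrite -sigE;
      apply: (chain_eq (j := l.+1) sigC1 ir (ltn_ord l)).
  rewrite (contiguity_num_den (iota_uniq _ _) (iota_uniq _ _) natU
    (shiftedU _ _ _) Jv t _ Il); congr (_ + _ * _).
    by apply: eq_hyper_coef => // i /eq_sig ->.
  by apply: eq_hyper_coef => // i /eq_sig ->.
have sig_neq i : i \in I -> (sig i == resid h s.+1) = false.
  by rewrite mem_index_iota; case: i => // i ir;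
    apply: (sig_none (Ordinal (ir : i < r.+1)%N)).
(* No upper parameter drops in the first term, hence all are raised in the second. *)
rewrite (contiguity_den _ (iota_uniq _ _) natU (shiftedU _ _ _) Jv t).
congr (_ + _ * _).
  by apply: eq_hyper_coef => // i /sig_neq ->; rewrite subr0.
by apply: eq_hyper_coef => // i /sig_neq ->.
Qed.

End Weights.

(** * Units of the coefficient ring, and the conclusion *)

Lemma natr_Rab_unit r s n : (n.+1%:R : Rab r s) \is a GRing.unit.
Proof.
rewrite -(rmorph_nat (mpolyC r (R := Qb s))) rmorph_unit // unitfE.
rewrite -(rmorph_nat (@tofrac _)) tofrac_eq0.
by rewrite -(rmorph_nat (mpolyC s (R := rat))) mpolyC_eq0 pnatr_eq0.
Qed.

Lemma avar_last r s : avar r s r.+1 = 1.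
Proof. by rewrite /avar insubF //= ltnn. Qed.

Lemma bvar_unit r s j (c : int) : (1 <= j <= s)%N ->
  bvar r s j + c%:~R \is a GRing.unit.
Proof.
case: j => // j js; rewrite /bvar (insubT (fun i => i < s)%N js).
rewrite -(rmorph_int (mpolyC r (R := Qb s))) -rmorphD rmorph_unit // unitfE.
rewrite -(rmorph_int (@tofrac _)) -rmorphD tofrac_eq0; apply/eqP.
(* Evaluating every b at 1 - c sends b_j + c to 1, so it is not the zero polynomial. *)
move=> /(congr1 (meval (fun=> 1 - c%:~R))); rewrite rmorphD rmorph_int.
rewrite /= mevalXU meval0 subrK; exact/eqP/oner_neq0.
Qed.

Theorem theorem7p1 (r s : nat) (hm : (1 <= maxn r s)%N) :
  ((s <= r)%N ->
   forall lam : nat -> nat, chain lam s r ->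
   forall n k : nat, (k <= n)%N ->
     stieltjes_rogers (maxn r s) (alpha_ge r s (avar r s) (bvar r s) lam) n k
     = closed_form r s (avar r s) (bvar r s) (maxn r s) lam n k)
  /\
  ((r <= s)%N ->
   forall sig : nat -> nat, chain sig r s -> sig r.+1 = s.+1 ->
   forall n k : nat, (k <= n)%N ->
     stieltjes_rogers (maxn r s) (alpha_le r s (avar r s) (bvar r s) sig) n k
     = closed_form r s (avar r s) (bvar r s) (maxn r s) (fun j => j) n k).
Proof.
have natU := @natr_Rab_unit r s; have a_last := avar_last r s.
have bU j (js : (1 <= j <= s)%N) c := bvar_unit r c js.
split=> [le_sr|le_rs].
  rewrite (maxn_idPl le_sr) in hm *.
  by move=> lam lamC n k; apply: stieltjes_rogers_alpha_ge.
rewrite (maxn_idPr le_rs) in hm *.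
by move=> sig sigC sig_last n k; apply: stieltjes_rogers_alpha_le.
Qed.
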